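(* The value $\operatorname{bdim}(G-e)-\operatorname{bdim}(G)$ can be arbitrarily larger than $d_{G-e}(u,v)$, where $e=uv$: for every $M$ there exist a connected graph $G$ and an edge $e=uv\in E(G)$ such that $G-e$ is connected and $\operatorname{bdim}(G-e)-\operatorname{bdim}(G)-d_{G-e}(u,v)\ge M$.
   Context: All graphs are finite, simple and undirected. $d_H(u,v)$ denotes the distance in graph $H$, and for a positive integer $k$, $d_k(u,v)=\min\{d(u,v),k+1\}$. A function $f:V(G)\to\mathbb{Z}_{\ge0}$ is a resolving broadcast of $G$ if for any distinct $x,y\in V(G)$ there is $z$ with $f(z)>0$ and $d_{f(z)}(x,z)\ne d_{f(z)}(y,z)$; $\operatorname{bdim}(G)$ is the minimum of $\sum_v f(v)$ over resolving broadcasts $f$ of $G$. $G-e$ denotes $G$ with the edge $e$ removed. *)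

(* Defs.v *)
From mathcomp Require Import all_boot all_order all_algebra.

Set Implicit Arguments.
Unset Strict Implicit.
Unset Printing Implicit Defensive.

Record sgraph := SGraph {
  vertex :> finType;
  adj : rel vertex;
  adj_sym : symmetric adj;
  adj_irr : irreflexive adj
}.

Definition connected (G : sgraph) : Prop :=
  forall x y : G, connect (@adj G) x y.

Definition del_rel (G : sgraph) (u v : G) : rel G :=
  [rel x y | adj x y && ([set x; y] != [set u; v])].

Lemma del_rel_sym (G : sgraph) (u v : G) : symmetric (del_rel u v).
Proof. by move=> x y; rewrite /del_rel /= adj_sym setUC. Qed.

Lemma del_rel_irr (G : sgraph) (u v : G) : irreflexive (del_rel u v).
Proof. by move=> x; rewrite /del_rel /= adj_irr. Qed.

Definition del_edge (G : sgraph) (u v : G) : sgraph :=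
  SGraph (@del_rel_sym G u v) (@del_rel_irr G u v).

Definition has_walk (G : sgraph) (x y : G) (n : nat) : bool :=
  [exists p : n.-tuple G, path (@adj G) x p && (last x p == y)].

(* Least length of a walk from x to y. When y is unreachable from x the value
   is #|G|, which exceeds every actual distance in G; truncation at k + 1 then
   separates the same pairs of vertices as an infinite distance would. *)
Definition dist (G : sgraph) (x y : G) : nat :=
  find (has_walk x y) (iota 0 #|G|).

Definition tdist (G : sgraph) (k : nat) (x y : G) : nat :=
  minn (dist x y) k.+1.

Definition resolving_broadcast (G : sgraph) (f : G -> nat) : bool :=
  [forall x : G, forall y : G, (x != y) ==>
    [exists z : G, (0 < f z) && (tdist (f z) x z != tdist (f z) y z)]].

Definition cost (G : sgraph) (f : G -> nat) : nat := \sum_(v : G) f v.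

(* A broadcast of cost n takes its values in {0, ..., n}, so the existence of
   a resolving broadcast of cost n is a finite search. *)
Definition has_broadcast (G : sgraph) (n : nat) : bool :=
  [exists f : {ffun G -> 'I_n.+1},
    resolving_broadcast (fun v => f v : nat)
    && (cost (fun v => f v : nat) == n)].

Lemma eq_resolving_broadcast (G : sgraph) (f g : G -> nat) :
  f =1 g -> resolving_broadcast f = resolving_broadcast g.
Proof.
move=> fg; apply: eq_forallb => x; apply: eq_forallb => y.
by congr (_ ==> _); apply: eq_existsb => z; rewrite fg.
Qed.

Lemma has_broadcastP (G : sgraph) (n : nat) :
  reflect (exists2 f : G -> nat, resolving_broadcast f & cost f = n)
          (has_broadcast G n).
Proof.
apply: (iffP existsP) => [[f /andP[rf /eqP cf]]|[f rf cf]].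
  by exists (fun v => f v : nat).
have fn v : f v < n.+1 by rewrite ltnS -cf /cost (bigD1 v) //= leq_addr.
have E : (fun v => [ffun v => Ordinal (fn v)] v : nat) =1 f.
  by move=> v; rewrite ffunE.
exists [ffun v => Ordinal (fn v)].
rewrite (eq_resolving_broadcast E) rf /= -[X in _ == X]cf.
by apply/eqP/eq_bigr => v _; rewrite E.
Qed.

Lemma has_walkP (G : sgraph) (x y : G) (n : nat) :
  reflect (exists p : seq G, [/\ path (@adj G) x p, last x p = y & size p = n])
          (has_walk x y n).
Proof.
apply: (iffP existsP) => [[p /andP[pp /eqP lp]]|[p [pp lp sp]]].
  by exists p; rewrite size_tuple.
by exists (tcast sp (in_tuple p)); rewrite val_tcast pp lp /=.
Qed.

Lemma dist_le (G : sgraph) (x : G) (p : seq G) :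
  path (@adj G) x p -> dist x (last x p) <= size p.
Proof.
move=> pp; rewrite leqNgt; apply/negP => lt.
have szG : size p < #|G|.
  by apply: leq_trans lt _; rewrite -[leqRHS](size_iota 0) find_size.
have w : has_walk x (last x p) (size p) by apply/has_walkP; exists p.
by have := before_find 0 lt; rewrite nth_iota // add0n w.
Qed.

Lemma dist_walk (G : sgraph) (x y : G) : connect (@adj G) x y ->
  exists p : seq G,
    [/\ path (@adj G) x p, last x p = y & size p = dist x y].
Proof.
case/connectP => p /shortenP[q pq uq _] ->.
have szq : size q < #|G|.
  by have := max_card (mem (x :: q)); rewrite (card_uniqP uq).
have hs : has (has_walk x (last x q)) (iota 0 #|G|).
  apply/hasP; exists (size q); first by rewrite mem_iota.
  by apply/has_walkP; exists q.
have := nth_find 0 hs; rewrite nth_iota ?add0n; last first.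
  by rewrite -[ltnRHS](size_iota 0) -has_find.
by move/has_walkP.
Qed.

Lemma dist_unreachable (G : sgraph) (x y : G) :
  ~~ connect (@adj G) x y -> dist x y = #|G|.
Proof.
move=> nc; rewrite /dist hasNfind ?size_iota //; apply/hasPn => n _.
apply: contra nc => /has_walkP[p [pp lp _]].
by apply/connectP; exists p.
Qed.

Lemma dist_eq0 (G : sgraph) (x y : G) : (dist x y == 0) = (x == y).
Proof.
apply/idP/eqP => [/eqP d0|->]; last first.
  by rewrite -leqn0 -[in dist _ _]/(last y [::]) (@dist_le G y [::]).
case: (boolP (connect (@adj G) x y)) => [/dist_walk[p [_ lp sp]]|].
  by move: sp lp; rewrite d0 => /size0nil ->.
move/dist_unreachable; rewrite d0 => /esym/card0_eq/(_ x).
by rewrite inE.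
Qed.

Lemma ex_broadcast (G : sgraph) : exists n, has_broadcast G n.
Proof.
exists (cost (fun _ : G => 1)); apply/has_broadcastP.
exists (fun=> 1) => //; apply/forallP => x; apply/forallP => y.
apply/implyP => xy; apply/existsP; exists x; rewrite /= /tdist.
have /eqP -> : dist x x == 0 by rewrite dist_eq0.
by rewrite min0n eq_sym -lt0n leq_min lt0n dist_eq0 eq_sym xy.
Qed.

Definition bdim (G : sgraph) : nat := ex_minn (ex_broadcast G).

Lemma bdim_witness (G : sgraph) :
  exists2 f : G -> nat, resolving_broadcast f & cost f = bdim G.
Proof. by rewrite /bdim; case: ex_minnP => n /has_broadcastP. Qed.

Lemma bdim_le (G : sgraph) (f : G -> nat) :
  resolving_broadcast f -> bdim G <= cost f.
Proof.
move=> rf; rewrite /bdim; case: ex_minnP => n _; apply.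
by apply/has_broadcastP; exists f.
Qed.

(* Main.v *)
(* Take three copies of a spider with long legs and join the three copies of
   each spider vertex [k] to a 4-cycle attached to [k]. Each 4-cycle consists of
   two pairs of twins, which forces cost 2 on it; conversely, strength 1 on one
   vertex of each pair resolves everything except the three copies of a common
   [k]. Let [e] join copies 0 and 1 of the body. In the presence of [e], copy 0
   of the body is at distance depth k + p from copy [p] of [k], so a single
   further transmitter there, of strength n + 2, suffices. Without [e], the
   copies can be permuted by automorphisms, so that copies [p] and [q] of [k]
   are only resolved by transmitters lying in copy [p] or [q]. The three copies
   of the tip of a leg then need transmitters in two different copies: either
   these are far away, of strength at least n + 1 each, or some transmitter lies
   on that leg; the latter cannot happen for all legs when there are 2n + 2 of
   them. The ends of [e] stay at distance 2 through the 4-cycle of the body. *)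

Require Import Defs.
From mathcomp Require Import all_boot all_order all_algebra.
From mathcomp Require Import all_fingroup zify.

Set Implicit Arguments.
Unset Strict Implicit.
Unset Printing Implicit Defensive.

(** * Distances, potentials and automorphisms in arbitrary graphs *)

Lemma dist_step (G : sgraph) (x y z : G) :
  connected G -> adj x y -> dist x z <= (dist y z).+1.
Proof.
move=> cG xy; have [p [pp <- <-]] := dist_walk (cG y z).
by have := @dist_le G x (y :: p); rewrite /= xy pp; apply.
Qed.

(** A potential that drops by at most 1 along each edge bounds distances from below. *)
Lemma lipschitz_dist (G : sgraph) (phi : G -> nat) :
  connected G -> (forall x y, adj x y -> phi x <= (phi y).+1) ->
  forall x y, phi x <= phi y + dist x y.
Proof.
move=> cG lip x y; have [p [pp <- <-]] := dist_walk (cG x y).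
elim: p x pp => [|z p IH] x /=; first by rewrite addn0.
by case/andP=> /lip xz /IH; lia.
Qed.

Lemma dist_involution (G : sgraph) (s : G -> G) :
  involutive s -> (forall x y, adj x y -> adj (s x) (s y)) ->
  forall x y, dist (s x) (s y) = dist x y.
Proof.
move=> sK sadj x y; apply: eq_find => n.
have walk a b : has_walk a b n -> has_walk (s a) (s b) n.
  case/has_walkP=> p [pp <- sz]; apply/has_walkP; exists (map s p).
  rewrite last_map size_map sz; split=> //.
  by rewrite path_map; apply: sub_path pp => u v; apply: sadj.
by apply/idP/idP => /walk //; rewrite !sK.
Qed.

(** An automorphism fixing [z] keeps distances to [z], so only a moved transmitter can separate [x]
    from [s x]. *)
Lemma resolving_moved (G : sgraph) (s : G -> G) (f : G -> nat) (x : G) :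
  involutive s -> (forall x y, adj x y -> adj (s x) (s y)) ->
  s x != x -> resolving_broadcast f ->
  exists z, [/\ 0 < f z, s z != z & tdist (f z) x z != tdist (f z) (s x) z].
Proof.
move=> sK sadj sx /forallP/(_ x)/forallP/(_ (s x))/implyP.
rewrite eq_sym => /(_ sx)/existsP[z /andP[fz dz]]; exists z; split=> //.
apply: contraNneq dz => sz.
by rewrite /tdist -(dist_involution sK sadj x z) sz.
Qed.

Lemma tdist1 (G : sgraph) (x z : G) : connected G ->
  tdist 1 x z = if x == z then 0 else if adj x z then 1 else 2.
Proof.
move=> cG; rewrite /tdist; case: eqVneq => [->|xz].
  by have /eqP -> : dist z z == 0 by rewrite dist_eq0.
have d0 : dist x z != 0 by rewrite dist_eq0.
case: ifP => [xa|/negP nxa].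
  have := @dist_le G x [:: z]; rewrite /= xa => /(_ isT); lia.
case: (dist_walk (cG x z)) => -[|y [|y' p]] /= [pp lp sp]; last by lia.
  by rewrite -sp in d0.
by case: nxa; rewrite -lp; case/andP: pp.
Qed.

(** * The graph, with and without the bridge *)

(* A spider whose [N] legs have [n + 1] vertices each; [None] is its body. *)
Definition spider (N n : nat) : finType := option ('I_N * 'I_n.+1).

Definition spider_adj N n (k k' : spider N n) : bool :=
  match k, k' with
  | None, None => false
  | None, Some (_, l) | Some (_, l), None => l == 0 :> nat
  | Some (i, l), Some (j, m) =>
      (i == j) && ((l.+1 == m) || (m.+1 == l))
  end.

Definition depth N n (k : spider N n) : nat :=
  if k is Some (_, l) then l.+1 else 0.

(** A potential that is [n.+1] at the tip of leg [i] and vanishes off that leg. *)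
Definition leg_depth N n (i : 'I_N) (k : spider N n) : nat :=
  if k is Some (j, l) then if j == i then l.+1 else 0 else 0.

(* [(k, inl p)] is the vertex [k] of the [p]-th copy of the spider; the
   [(k, inr (b, c))] form a 4-cycle joined to the three copies of [k], in which
   [(k, inr (b, true))] and [(k, inr (b, false))] are twins. *)
Definition tvert (N n : nat) : finType := (spider N n * ('I_3 + bool * bool))%type.

(* [bridge] tells whether copies 0 and 1 of the body are adjacent. *)
Definition tadj (bridge : bool) N n (x y : tvert N n) : bool :=
  match x, y with
  | (k, inl p), (k', inl q) =>
      (spider_adj k k' && (p == q))
      || [&& bridge, k == None, k' == None & p + q == 1]
  | (k, inr (b, _)), (k', inr (b', _)) => (k == k') && (b != b')
  | (k, _), (k', _) => k == k'
  end.

Lemma spider_adj_sym N n : symmetric (@spider_adj N n).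
Proof.
by move=> [[i l]|] [[j m]|] //=; rewrite (eq_sym i) orbC.
Qed.

Lemma spider_adj_irr N n : irreflexive (@spider_adj N n).
Proof. by move=> [[i l]|] //=; rewrite eqxx orbb; lia. Qed.

Lemma tadj_sym b N n : symmetric (@tadj b N n).
Proof.
move=> [k [p|[b1 c1]]] [k' [q|[b2 c2]]] /=; rewrite ?(eq_sym k) //.
  rewrite spider_adj_sym (eq_sym p) addnC.
  by case: (k == None); case: (k' == None); rewrite ?andbF.
by rewrite (eq_sym b1).
Qed.

Lemma tadj_irr b N n : irreflexive (@tadj b N n).
Proof.
move=> [k [p|[b1 c1]]] /=; rewrite ?eqxx ?spider_adj_irr //=.
by apply/negbTE; rewrite !negb_and; lia.
Qed.

Definition tgraph N n : sgraph :=
  SGraph (@tadj_sym true N n) (@tadj_irr true N n).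

Definition skel N n (k : spider N n) (p : 'I_3) : tgraph N n := (k, inl p).

Definition tgraph_del N n : sgraph :=
  @del_edge (tgraph N n) (skel None ord0) (skel None (inord 1)).

Lemma tgraph_del_adj N n (x y : tgraph N n) :
  @adj (tgraph_del N n) x y = tadj false x y.
Proof.
have v1 : (inord 1 : 'I_3) = 1 :> nat by rewrite inordK.
rewrite /= /del_rel /=; set E := (X in _ && ~~ X).
(* Copy numbers summing to 1 are exactly 0 and 1, so the flag governs the deleted edge and no
   other. *)
suff -> : E = [&& x.1 == None, y.1 == None &
    match x.2, y.2 with inl p, inl q => p + q == 1 | _, _ => false end].
  case: x y {E} => [k [p|[b c]]] [k' [q|[b' c']]] /=; rewrite ?andbF ?andbT //.
  case: (eqVneq k None) => [->|]; case: (eqVneq k' None) => [->|] //=;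
    rewrite ?andbT ?orbF ?andbN //.
apply/eqP/idP => [e|].
  have xe : x \in [set @skel N n None ord0; @skel N n None (inord 1)] by rewrite -e !inE eqxx.
  have ye : y \in [set @skel N n None ord0; @skel N n None (inord 1)]
    by rewrite -e !inE eqxx orbT.
  have e0 : @skel N n None ord0 \in [set x; y] by rewrite e !inE eqxx.
  have e1 : @skel N n None (inord 1) \in [set x; y] by rewrite e !inE eqxx orbT.
  have ne : (ord0 : 'I_3) != inord 1 by rewrite -val_eqE /= v1.
  move: xe ye e0 e1; rewrite !inE.
  case/orP=> /eqP -> ; case/orP=> /eqP ->; rewrite /skel ?xpair_eqE /= ?v1 //=.
    by move=> _; rewrite orbb => /eqP[] h; rewrite h eqxx in ne.
  by rewrite orbb => /eqP[] h; rewrite h eqxx in ne.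
case: x y {E} => [k [p|[b c]]] [k' [q|[b' c']]] /=; rewrite ?andbF //.
case/and3P=> /eqP-> /eqP-> pq.
have [[p0 q1]|[p1 q0]] : (p = 0 :> nat /\ q = 1 :> nat) \/ (p = 1 :> nat /\ q = 0 :> nat)
  by lia.
  by congr [set _; _]; congr (_, inl _); apply: val_inj; rewrite /= ?v1.
by rewrite setUC; congr [set _; _]; congr (_, inl _); apply: val_inj; rewrite /= ?v1.
Qed.

Lemma tgraph_del_connected N n : connected (tgraph_del N n).
Proof.
set G := tgraph_del N n; set r : G := (None, inr (true, true)).
have csym : connect_sym (@adj G) by apply: sym_connect_sym; apply: adj_sym.
have c1 x y : tadj false x y -> connect (@adj G) x y.
  by rewrite -tgraph_del_adj; apply: connect1.
have cskel (k : spider N n) p : connect (@adj G) (k, inl p) r.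
  case: k => [[i [l ln]]|]; last by apply: c1.
  elim: l ln => [|l IH] ln.
    by apply: (@connect_trans _ _ (None, inl p)); apply: c1; rewrite /= ?eqxx.
  apply: connect_trans (IH (ltnW ln)); apply: c1.
  by rewrite /= !eqxx orbT.
have call x : connect (@adj G) x r.
  case: x => k [p|g]; first exact: cskel.
  by apply: connect_trans (cskel k ord0); apply: c1; case: g => b c /=.
by move=> x y; apply: connect_trans (call x) _; rewrite csym.
Qed.

Lemma tgraph_connected N n : connected (tgraph N n).
Proof.
move=> x y; apply: connect_sub (tgraph_del_connected x y) => a b /= /andP[ab _].
exact: connect1.
Qed.

Lemma tgraph_eqE N n (x y : tgraph N n) : (x == y) = (x.1 == y.1) && (x.2 == y.2).
Proof. by []. Qed.

(** * Upper bound in the presence of the edge *)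

Lemma dist_body_le N n (k : spider N n) p (z : tgraph N n) :
  dist (skel k p) z <= depth k + dist (skel None p) z.
Proof.
case: k => [[i [l ln]]|] //=; have cG := @tgraph_connected N n.
elim: l ln => [|l IH] ln.
  by rewrite add1n; apply: dist_step => //=; rewrite eqxx.
rewrite addSn.
apply: leq_trans
  (_ : _ <= (dist (skel (Some (i, Ordinal (ltnW ln))) p) z).+1) _.
  by apply: dist_step => //=; rewrite !eqxx orbT.
by rewrite ltnS; apply: IH.
Qed.

Lemma dist_body_ge N n (k : spider N n) (p : 'I_3) :
  depth k + p <= dist (skel k p) (@skel N n None ord0).
Proof.
(* The offset 1 on the 4-cycles differs by at most 1 from each copy number 0, 1, 2. *)
pose phi (x : tgraph N n) := match x with
  | (k, inl p) => depth k + p | (k, inr _) => depth k + 1 end.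
suff lip (x y : tgraph N n) : adj x y -> phi x <= (phi y).+1.
  exact: (lipschitz_dist (@tgraph_connected N n) lip (skel k p) (skel None ord0)).
case: x y => [k1 [p1|[b1 c1]]] [k2 [p2|[b2 c2]]] /=.
- case/orP=> [/andP[kk /eqP ->]|/and3P[/eqP -> /eqP -> /=]]; last by lia.
  case: k1 k2 kk => [[i l]|] [[j m]|] //=; lia.
- by move=> /eqP ->; have := ltn_ord p1; lia.
- by move=> /eqP ->; lia.
- by case/andP=> /eqP -> _; lia.
Qed.

Definition tgraph_broadcast N n (x : tgraph N n) : nat :=
  match x with
  | (k, inl p) => if (k == None) && (p == ord0) then n.+2 else 0
  | (_, inr (_, c)) => c
  end.

Lemma tgraph_broadcast_skel N n (k : spider N n) (p q : 'I_3) : p < q ->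
  tdist n.+2 (skel k p) (@skel N n None ord0)
  != tdist n.+2 (skel k q) (@skel N n None ord0).
Proof.
(* Since [p] is at most 1, the nearer distance is at most [depth k + 1 <= n.+2], below the
   truncation value [n.+3]. *)
move=> pq; have dk : depth k <= n.+1 by case: k => [[i l]|] //=; apply: ltn_ord.
have := dist_body_ge k q; have := dist_body_le k p (@skel N n None ord0).
have : dist (skel None p) (@skel N n None ord0) <= p.
  have [->|->] : p = ord0 \/ p = inord 1.
    have : p = 0 :> nat \/ p = 1 :> nat by have := ltn_ord q; lia.
    by case=> h; [left|right]; apply: val_inj; rewrite /= ?inordK.
  - by have := @dist_eq0 (tgraph N n) (@skel N n None ord0) (@skel N n None ord0);
      rewrite eqxx => /eqP ->.
  - have := @dist_le (tgraph N n) (@skel N n None (inord 1)) [:: @skel N n None ord0].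
    by rewrite /= inordK //; apply.
have := ltn_ord q; rewrite /tdist; lia.
Qed.

Lemma tgraph_broadcast_resolving N n : resolving_broadcast (@tgraph_broadcast N n).
Proof.
set f := @tgraph_broadcast N n; have cG := @tgraph_connected N n.
apply/forallP => x; apply/forallP => y; apply/implyP; apply: contraNT.
move/existsPn => nres.
have same z : 0 < f z -> tdist (f z) x z = tdist (f z) y z.
  by move=> fz; apply/eqP; have := nres z; rewrite fz negbK.
have gad k b : (x == (k, inr (b, true))) = (y == (k, inr (b, true))) /\
    tadj true x (k, inr (b, true)) = tadj true y (k, inr (b, true)).
  have := same (k, inr (b, true)) isT; rewrite !tdist1 //.
  case: eqVneq => [->|_]; case: eqVneq => [->|_] //; rewrite /= ?eqxx ?andbF //;
    by do ![case: ifP => //].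
(* Of the two transmitters at [k], a cycle vertex at [k] is adjacent to exactly one, a copy of [k]
   to both, all other vertices to none; equality with a transmitter then tells twins apart. *)
have gadget (u v : tgraph N n) k b c : u = (k, inr (b, c)) ->
    (forall k b, (u == (k, inr (b, true))) = (v == (k, inr (b, true))) /\
      tadj true u (k, inr (b, true)) = tadj true v (k, inr (b, true))) -> u = v.
  move=> -> code; have [e1 a1] := code k b; have [_ a2] := code k (~~ b).
  move: a2 a1 e1; case: v {code} => k' [q|[b' c']]; rewrite /= !eqxx.
    by case: b => /= <-.
  rewrite !tgraph_eqE /= eqxx; case: (eqVneq k' k) => [->|] /=; last by case: b.
  by case: b; case: b'; case: c; case: c'.
case: x y gad same {nres} => [k [p|[b c]]] [k' [q|[b' c']]] gad same.
(* Adjacency to the 4-cycle identifies the spider vertex; the strong transmitter identifies the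
   copy. *)
- have /= := (gad k true).2; rewrite eqxx => /esym/eqP kk; rewrite kk in same *.
  have := same (skel None ord0) isT; rewrite /f /= => e.
  case: (ltngtP p q) => [pq|qp|/val_inj ->] //.
    by have := tgraph_broadcast_skel k pq; rewrite e eqxx.
  by have := tgraph_broadcast_skel k qp; rewrite e eqxx.
- by apply/eqP/esym/(@gadget _ _ k' b' c') => // a d; have [-> ->] := gad a d.
- exact/eqP/(@gadget _ _ k b c).
- exact/eqP/(@gadget _ _ k b c).
Qed.

Lemma cost_tgraph N n (f : tgraph N n -> nat) :
  cost f = \sum_(kp : spider N n * 'I_3) f (skel kp.1 kp.2)
         + \sum_(kb : spider N n * bool)
             (f (kb.1, inr (kb.2, true)) + f (kb.1, inr (kb.2, false))).
Proof.
have -> : cost f = \sum_k \sum_g f (k, g).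
  by rewrite pair_bigA; apply: eq_bigr => -[].
rewrite -(pair_bigA _ (fun k p => f (skel k p))) /=.
rewrite -(pair_bigA _ (fun k b => f (k, inr (b, true)) + f (k, inr (b, false)))) /=.
rewrite -big_split; apply: eq_bigr => k _; rewrite big_sumType /=; congr (_ + _).
transitivity (\sum_b \sum_c f (k, inr (b, c))).
  by rewrite pair_bigA; apply: eq_bigr => -[].
by apply: eq_bigr => b _; rewrite big_bool.
Qed.

Lemma bdim_tgraph_le N n : bdim (tgraph N n) <= n.+2 + #|{: spider N n * bool}|.
Proof.
apply: leq_trans (bdim_le (@tgraph_broadcast_resolving N n)) _.
rewrite cost_tgraph leq_add //; last by rewrite /= sum1_card.
rewrite (bigD1 (None, ord0)) //= big1 ?addn0 // => -[k p].
by rewrite xpair_eqE /= => /negbTE ->.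
Qed.

(** * Lower bound in the absence of the edge *)

Lemma twins_cost N n (f : tgraph_del N n -> nat) :
  resolving_broadcast f ->
  #|{: spider N n * bool}| <= \sum_(kb : spider N n * bool)
             (f (kb.1, inr (kb.2, true)) + f (kb.1, inr (kb.2, false))).
Proof.
move=> rf; rewrite -sum1_card; apply: leq_sum => -[k b] _ /=.
(* The exchange of a single pair of twins, which moves nothing else. *)
pose s (x : tgraph_del N n) : tgraph_del N n := match x with
  | (k', inr (b', c)) => (k', inr (b', if (k' == k) && (b' == b) then ~~ c else c))
  | _ => x end.
have sK : involutive s.
  by move=> [k' [p|[b' c]]] //=; case: (_ && _); rewrite ?negbK.
have sadj (x y : tgraph_del N n) : adj x y -> adj (s x) (s y).
  by rewrite !tgraph_del_adj; case: x y => [k1 [p|[b1 c1]]] [k2 [q|[b2 c2]]].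
have moved : s (k, inr (b, true)) != (k, inr (b, true)).
  by apply/eqP => -[]; rewrite !eqxx.
have [z [fz sz _]] := resolving_moved sK sadj moved rf.
case: z fz sz => [k' [p|[b' c]]] fz; rewrite /= ?eqxx //.
case: ifP => [/andP[/eqP kk /eqP bb]|_]; last by rewrite eqxx.
by move=> _; rewrite -kk -bb; case: c fz => fz; rewrite ?addn_gt0 fz ?orbT.
Qed.

(** Exchanging copies [p] and [q] is an automorphism once the bridge is gone. The two tips of leg
    [i] thus need a transmitter in one of these copies; it lies off the leg, hence farther than [n]
    from both tips, and strength at most [n] would truncate both distances alike. *)
Lemma skel_transmitter N n (f : tgraph_del N n -> nat) (i : 'I_N) (p q : 'I_3) :
  resolving_broadcast f -> p != q ->
  (forall l r, f (skel (Some (i, l)) r) = 0) ->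
  exists k r, [/\ r \in [:: p; q] & n < f (skel k r)].
Proof.
move=> rf pq f0.
pose s (x : tgraph_del N n) : tgraph_del N n := match x with
  | (k, inl r) => (k, inl (tperm p q r)) | _ => x end.
have sK : involutive s by move=> [k [r|g]] //=; rewrite tpermK.
have sadj (x y : tgraph_del N n) : adj x y -> adj (s x) (s y).
  rewrite !tgraph_del_adj; case: x y => [k1 [r|g]] [k2 [r'|g']] //=.
  by rewrite !orbF (inj_eq perm_inj).
have moved : s (skel (Some (i, ord_max)) p) != skel (Some (i, ord_max)) p.
  by apply/eqP => -[] /eqP; rewrite tpermL eq_sym (negbTE pq).
have [z [fz sz]] := resolving_moved sK sadj moved rf.
case: z fz sz => [k [r|g]] fz; rewrite /= ?eqxx // => rm.
pose phi (x : tgraph_del N n) := leg_depth i x.1.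
have lip (x y : tgraph_del N n) : adj x y -> phi x <= (phi y).+1.
  rewrite tgraph_del_adj; case: x y => [k1 g] [k2 g'] adj12.
  have {adj12} : (k1 == k2) || spider_adj k1 k2.
    case: g g' adj12 => [r1|[b1 c1]] [r2|[b2 c2]] /=; rewrite ?orbF.
    - by case/andP=> ->; rewrite orbT.
    - by move=> ->.
    - by move=> ->.
    - by case/andP=> ->.
  case/orP=> [/eqP ->|]; first exact: leqnSn.
  rewrite /phi /=; case: k1 k2 => [[j l]|] [[j' l']|] //=.
    by case/andP=> /eqP ->; case: ifP => _; lia.
  by case: ifP => _; lia.
have far t : n < dist (skel (Some (i, ord_max)) t : tgraph_del N n) (k, inl r).
  have := lipschitz_dist (@tgraph_del_connected N n) lip (skel (Some (i, ord_max)) t) (k, inl r).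
  rewrite /phi /= eqxx; suff -> : leg_depth i k = 0 by [].
  case: k fz {rm} => [[j l]|] //=; case: eqVneq => // ->.
  by rewrite -[X in f X]/(skel (Some (i, l)) r) f0.
rewrite tpermL => neq; exists k, r; split.
  rewrite !inE; apply: contraNT rm; rewrite negb_or => /andP[rp rq].
  by rewrite tpermD // eq_sym.
rewrite ltnNge; apply: contra neq => fn; rewrite /tdist /=.
by rewrite !(minn_idPr _) //; apply: leq_ltn_trans fn (far _).
Qed.

Lemma skel_cost N n (f : tgraph_del N n -> nat) :
  resolving_broadcast f -> N = n.+1.*2 ->
  n.+1.*2 <= \sum_(kp : spider N n * 'I_3) f (skel kp.1 kp.2).
Proof.
move=> rf Nn; pose A := [set kp : spider N n * 'I_3 | 0 < f (skel kp.1 kp.2)].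
pose leg (kp : spider N n * 'I_3) := omap fst kp.1.
case: (boolP [forall i, Some i \in leg @: A]) => [/forallP allA|/forallPn[i iA]].
  have NA : N <= #|A|.
    rewrite -[N in N <= _]card_ord -(card_imset _ (@Some_inj _ : injective (@Some 'I_N))).
    apply: leq_trans (leq_imset_card leg A).
  apply/subset_leq_card/subsetP => _ /imsetP[i _ ->].
    exact: allA.
  rewrite -Nn (leq_trans NA) // -sum1_card big_mkcond.
  by apply: leq_sum => kp _; rewrite inE; case: ifP.
have f0 l r : f (skel (Some (i, l)) r) = 0.
  apply/eqP; rewrite -leqn0 leqNgt; apply: contra iA => fp.
  by apply/imsetP; exists (Some (i, l), r); rewrite ?inE.
have [k [p [_ fp]]] := skel_transmitter rf (isT : (ord0 : 'I_3) != ord_max) f0.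
(* The two copies other than [p] yield a second strong transmitter, distinct from the first. *)
have neq : lift p ord0 != lift p ord_max by rewrite (inj_eq lift_inj).
have [k' [q [qp fq]]] := skel_transmitter rf neq f0.
have pq : q != p.
  by move: qp; rewrite !inE => /orP[] /eqP ->; rewrite eq_sym neq_lift.
rewrite (bigD1 (k, p)) //= (bigD1 (k', q)) /=; last by rewrite xpair_eqE negb_and pq orbT.
lia.
Qed.

Theorem theorem1p9 (M : int) :
  exists (G : sgraph) (u v : G),
    [/\ connected G, adj u v, connected (del_edge u v)
      & (M <= (bdim (del_edge u v))%:Z - (bdim G)%:Z
              - (@dist (del_edge u v) u v)%:Z)%R].
Proof.
(* The costs of the twins cancel, which leaves at least [2 * (n + 1) - (n + 2) - 2 = n - 2], that
   is, the absolute value of [M]. *)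
pose n := `|M|%N.+2; pose N := n.+1.*2.
exists (tgraph N n), (skel None ord0), (skel None (inord 1)); split.
- exact: tgraph_connected.
- by rewrite /= inordK.
- exact: tgraph_del_connected.
rewrite -/(tgraph_del N n).
have d2 : @dist (tgraph_del N n) (skel None ord0) (skel None (inord 1)) <= 2.
  have := @dist_le (tgraph_del N n) (skel None ord0)
    [:: (None, inr (true, true)); skel None (inord 1)].
  by apply; rewrite /path !tgraph_del_adj.
have := bdim_tgraph_le N n.
have [f rf <-] := bdim_witness (tgraph_del N n).
(* Both graphs have the same vertices, so the splitting of the cost carries over. *)
have -> : cost f = @cost (tgraph N n) f by [].
rewrite cost_tgraph; have := skel_cost rf erefl; have := twins_cost rf.
move: d2; rewrite /n; lia.
Qed.
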